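(* Let $k$ be a field and let $P_n$ be the path graph on $n\ge4$ vertices $1,\dots,n$, with edges $\{i,i+1\}$ for each integer $1\le i\le n-1$. Then $\operatorname{cs}(k(P_n))=n$ and $\left\lceil\frac n2\right\rceil\le\operatorname{ms}(k(P_n))\le n-1$.
   Context: For a finite simple graph $G$ on $\{1,\dots,n\}$, the edge ring over $k$ is $k(G)=k[x_1,\dots,x_n]/I(G)$, where $I(G)=(x_ix_j\mid\{i,j\}\text{ is an edge of }G)$; it is standard graded with homogeneous maximal ideal $\bar{\mathfrak m}$ (the image of $(x_1,\dots,x_n)$). For a homogeneous ideal $J$ of $k(G)$, $\mu(J)=\dim_k(J/\bar{\mathfrak m}J)$, and $$\operatorname{cs}(k(G))=\min\{\mu(J): J\subseteq\bar{\mathfrak m} \text{ homogeneous with } J^2=\bar{\mathfrak m}^2\},\qquad \operatorname{ms}(k(G))=\min\{\mu(J): J\subseteq \bar{\mathfrak m} \text{ homogeneous with } J\supseteq \bar{\mathfrak m}^2\}.$$ *)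

(* Defs.v *)
From HB Require Import structures.
From mathcomp Require Import all_boot all_order all_algebra.
From mathcomp Require Import boolp classical_sets.
From mathcomp Require Import mpoly.

Set Implicit Arguments.
Unset Strict Implicit.
Unset Printing Implicit Defensive.

Import GRing.Theory.

Local Open Scope classical_set_scope.
Local Open Scope ring_scope.
Local Open Scope quotient_scope.

Section Ideals.
Variable R : comNzRingType.
Implicit Types (S J K : set R).

Definition is_ideal J : Prop :=
  [/\ J 0, forall x y, J x -> J y -> J (x + y) & forall a x, J x -> J (a * x)].

Definition ideal_gen S : set R :=
  [set x | exists s : seq (R * R),
     (forall p, p \in s -> S p.2) /\ x = \sum_(p <- s) p.1 * p.2].

Definition ideal_mul J K : set R :=
  ideal_gen [set x | exists a b, [/\ J a, K b & x = a * b]].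

End Ideals.

Record sgraph (n : nat) := SGraph {
  edge :> rel 'I_n;
  edge_sym : ssrbool.symmetric edge;
  edge_irr : irreflexive edge }.

(* Vertices are numbered 0, ..., n - 1. *)
Definition path_edge (n : nat) : rel 'I_n :=
  fun i j => (i.+1 == j :> nat) || (j.+1 == i :> nat).

Lemma path_edge_sym n : ssrbool.symmetric (@path_edge n).
Proof. by move=> i j; rewrite /path_edge orbC. Qed.

Lemma path_edge_irr n : irreflexive (@path_edge n).
Proof. by move=> i; rewrite /path_edge orbb; apply/negbTE; rewrite eqn_leq ltnn. Qed.

Definition path_graph (n : nat) : sgraph n :=
  SGraph (@path_edge_sym n) (@path_edge_irr n).

Section EdgeIdeal.
Variables (k : fieldType) (n : nat) (G : sgraph n).

Definition edge_monomials : set {mpoly k[n]} :=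
  [set q | exists i j : 'I_n, G i j /\ q = 'X_i * 'X_j].

(* The boolean reflection is what the library quotient requires of an ideal. *)
Definition edge_ideal : {mpoly k[n]} -> bool :=
  fun p => `[< ideal_gen edge_monomials p >].

Lemma edge_ideal_closed : idealr_closed edge_ideal.
Proof.
split.
- apply/asboolP; exists [::]; split=> //; by rewrite big_nil.
- apply/asboolP => -[s [sE /(congr1 (meval (fun=> 0)))]].
  rewrite meval1 rmorph_sum big_seq big1 => [/eqP|p /sE [i [j [_ pE]]]].
    by rewrite oner_eq0.
  by rewrite /= pE !rmorphM /= mevalXU mul0r mulr0.
- move=> a u v /asboolP [s [sE ->]] /asboolP [t [tE ->]]; apply/asboolP.
  exists ([seq (a * p.1, p.2) | p <- s] ++ t); split.
    move=> p; rewrite mem_cat => /orP[/mapP[q qs ->] /=|]; first exact: sE.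
    exact: tE.
  rewrite big_cat big_map /= mulr_sumr; congr (_ + _).
  by apply: eq_bigr => p _; rewrite mulrA.
Qed.

HB.instance Definition _ :=
  isIdealr.Build {mpoly k[n]} edge_ideal edge_ideal_closed.

Definition edge_ring : Type :=
  {ideal_quot (edge_ideal : idealr {mpoly k[n]})}.
HB.instance Definition _ := GRing.ComNzRing.on edge_ring.

Definition edge_proj : {mpoly k[n]} -> edge_ring := \pi_edge_ring.
HB.instance Definition _ := GRing.RMorphism.on edge_proj.

Definition edge_scale (c : k) (a : edge_ring) : edge_ring :=
  edge_proj c%:MP * a.

Lemma edge_scaleA a b v :
  edge_scale a (edge_scale b v) = edge_scale (a * b) v.
Proof. by rewrite /edge_scale mulrA -rmorphM -mpolyCM. Qed.

Lemma edge_scale1 : left_id 1 edge_scale.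
Proof. by move=> v; rewrite /edge_scale rmorph1 mul1r. Qed.

Lemma edge_scaleDr : right_distributive edge_scale +%R.
Proof. by move=> a u v; rewrite /edge_scale mulrDr. Qed.

Lemma edge_scaleDl v : {morph edge_scale^~ v : a b / a + b}.
Proof. by move=> a b; rewrite /edge_scale mpolyCD rmorphD mulrDl. Qed.

HB.instance Definition _ := GRing.Zmodule_isLmodule.Build k edge_ring
  edge_scaleA edge_scale1 edge_scaleDr edge_scaleDl.

Lemma edge_scaleAl (a : k) (u v : edge_ring) : a *: (u * v) = (a *: u) * v.
Proof. exact: mulrA. Qed.

HB.instance Definition _ := GRing.Lmodule_isLalgebra.Build k edge_ring
  edge_scaleAl.

Definition edge_max : set edge_ring :=
  edge_proj @` ideal_gen [set q | exists i : 'I_n, q = 'X_i].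

Definition edge_deg (d : nat) : set edge_ring :=
  edge_proj @` [set p | p \is d.-homog].

Definition homog_ideal (J : set edge_ring) : Prop :=
  is_ideal J /\
  forall a, J a -> exists (m : nat) (b : 'I_m -> edge_ring),
    (forall d : 'I_m, J (b d) /\ edge_deg d (b d)) /\ a = \sum_d b d.

(* The residue classes of b form a k-basis of the quotient of J by
   edge_max * J. A relation, because finiteness of the dimension is not
   presupposed. *)
Definition mu_is (J : set edge_ring) (d : nat) : Prop :=
  exists b : 'I_d -> edge_ring,
    [/\ forall i, J (b i),
        forall f, J f -> exists c : 'I_d -> k,
          ideal_mul edge_max J (f - \sum_i c i *: b i)
      & forall c : 'I_d -> k,
          ideal_mul edge_max J (\sum_i c i *: b i) -> forall i, c i = 0].

End EdgeIdeal.

(* Least element of S, with value 0 when S is empty. *)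
Definition nat_min (S : set nat) : nat :=
  xget 0%N [set d | S d /\ forall e, S e -> (d <= e)%N].

Definition cs (k : fieldType) (n : nat) (G : sgraph n) : nat :=
  let m := @edge_max k n G in
  nat_min [set d | exists J : set (edge_ring k G),
    [/\ homog_ideal J, J `<=` m, ideal_mul J J = ideal_mul m m & mu_is J d]].

Definition ms (k : fieldType) (n : nat) (G : sgraph n) : nat :=
  let m := @edge_max k n G in
  nat_min [set d | exists J : set (edge_ring k G),
    [/\ homog_ideal J, J `<=` m, ideal_mul m m `<=` J & mu_is J d]].

(* Main.v *)
From HB Require Import structures.
Require Import Defs.
From mathcomp Require Import all_boot all_algebra.
From mathcomp Require Import ring zify.
From mathcomp Require Import boolp classical_sets mpoly.

Set Implicit Arguments.
Unset Strict Implicit.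
Unset Printing Implicit Defensive.

Import GRing.Theory.

(** Everything is read off the constant and linear coefficients [cst], [lin],
    which are well defined on the edge ring because edge monomials are quadratic.

    Reductions: if J^2 = m^2 and J needs fewer than n generators, the linear
    parts of J lie in a hyperplane c = 0. The quadratic forms vanishing on the
    square of that hyperplane form an n-dimensional space (they are c times a
    linear form, polarised), and the n - 1 edges impose n - 1 linear conditions
    on it, so some nonzero one descends to the edge ring, kills J^2 but not m^2.

    Lower bound for ms: for an independent set of size s, every point p supported
    on it gives a ring map x_i |-> p_i X from the edge ring to k[X]. Choose a
    basis of the r points p at which all linear parts of J vanish. The X^2
    coefficients along these r rays kill mJ and are independent on m^2, while the
    linear parts account for s - r further generators of J.

    Upper bound for ms: if {i0, i1} is an edge, the n - 1 elements
    x_i1 - x_i0 and x_i (i <> i0, i1) generate an ideal containing m^2, since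
    x_i1^2 = x_i1 (x_i1 - x_i0) and similarly for x_i0^2. *)

(** * Generated ideals and products of ideals *)

Section Ideals.
Local Open Scope ring_scope.
Variable R : comNzRingType.
Implicit Types (S J K : set R).

Lemma ideal_gen_ideal S : is_ideal (ideal_gen S).
Proof.
split.
- by exists [::]; split=> //; rewrite big_nil.
- move=> x y [s [sS ->]] [t [tS ->]]; exists (s ++ t); split; last by rewrite big_cat.
  by move=> p; rewrite mem_cat => /orP[/sS|/tS].
- move=> a x [s [sS ->]]; exists [seq (a * p.1, p.2) | p <- s]; split.
    by move=> p /mapP[q qs ->] /=; exact: sS.
  by rewrite big_map mulr_sumr; apply: eq_bigr => p _; rewrite mulrA.
Qed.

Lemma ideal_gen_sub S J : is_ideal J ->
  (forall x, S x -> J x) -> forall x, ideal_gen S x -> J x.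
Proof.
move=> [J0 JD JM] SJ x [s [sS ->]]; rewrite big_seq.
by elim/big_ind: _ => // p /sS pS; apply/JM/SJ.
Qed.

Lemma ideal_gen_mem S x : S x -> ideal_gen S x.
Proof.
move=> Sx; exists [:: (1, x)]; rewrite big_seq1 mul1r.
by split=> // p; rewrite inE => /eqP ->.
Qed.

Lemma ideal_sum J (I : Type) (r : seq I) (P : pred I) (F : I -> R) :
  is_ideal J -> (forall i, P i -> J (F i)) -> J (\sum_(i <- r | P i) F i).
Proof. by move=> [J0 JD _] JF; elim/big_ind: _. Qed.

Lemma ideal_opp J x : is_ideal J -> J x -> J (- x).
Proof. by move=> [_ _ JM] Jx; rewrite -mulN1r; apply: JM. Qed.

Lemma ideal_sub J x y : is_ideal J -> J x -> J y -> J (x - y).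
Proof. by move=> idJ Jx Jy; case: (idJ) => _ + _; apply; last exact: ideal_opp. Qed.

Lemma ideal_mul_ideal J K : is_ideal (ideal_mul J K).
Proof. exact: ideal_gen_ideal. Qed.

Lemma ideal_mulM J K x y : J x -> K y -> ideal_mul J K (x * y).
Proof. by move=> Jx Ky; apply: ideal_gen_mem; exists x, y. Qed.

Lemma ideal_mul_sub J K L : is_ideal L ->
  (forall x y, J x -> K y -> L (x * y)) -> forall x, ideal_mul J K x -> L x.
Proof.
move=> idL JKL; apply: ideal_gen_sub => // x [a [b [Ja Kb ->]]]; exact: JKL.
Qed.

End Ideals.

(** * Restriction of polynomials to lines through the origin *)

Section Ray.
Local Open Scope ring_scope.
Variables (k : fieldType) (n : nat).
Implicit Types (p : 'I_n -> k) (f g : {mpoly k[n]}).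

(* Restriction of a polynomial to the line spanned by p: the coefficient of X^d
   is the value at p of the component of degree d. *)
Definition ray p : {mpoly k[n]} -> {poly k} :=
  mmap (@polyC k) (fun i => p i *: 'X).
HB.instance Definition _ p := GRing.RMorphism.on (ray p).

Lemma rayX p i : ray p 'X_i = p i *: 'X.
Proof. by rewrite /ray mmapX mmap1U. Qed.

Lemma rayZ p c f : ray p (c *: f) = c *: ray p f.
Proof. by rewrite /ray mmapZ mul_polyC. Qed.

Lemma rayXm p m :
  ray p 'X_[m] = (\prod_(i < n) p i ^+ m i) *: 'X^(mdeg m).
Proof.
rewrite /ray mmapX /mmap1 mdegE.
rewrite (eq_bigr (fun i => (p i ^+ m i)%:P * 'X^(m i))).
  by rewrite big_split /= -rmorph_prod mul_polyC prodrXr.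
by move=> i _; rewrite exprZn mul_polyC.
Qed.

(** A monomial of degree [e] goes to a multiple of ['X^e], so taking a homogeneous component either
    keeps a coefficient along the ray or kills it. *)
Lemma ray_pihomog p d e f :
  (ray p (pihomog mdeg d f))`_e = if e == d then (ray p f)`_e else 0.
Proof.
elim/mpolyind: f => [|c m f _ _ IH].
  by rewrite !linear0 raddf0 coef0 if_same.
rewrite !linearP /= !rmorphD /= !coefD IH pihomogX !rayZ.
case: (eqVneq (mdeg m) d) => md.
  rewrite rayXm !coefZ coefXn -md; case: (eqVneq e) => // _.
  by rewrite !mulr0 addr0.
rewrite raddf0 !coefZ coef0 mulr0 add0r rayXm coefZ coefXn.
case: (eqVneq e d) => [->|//]; rewrite eq_sym (negbTE md) !mulr0 add0r //.
Qed.

Lemma ray0 p f : (ray p f)`_0 = f@_0.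
Proof.
elim/mpolyind: f => [|c m f _ _ IH]; first by rewrite !raddf0 coef0.
rewrite !rmorphD /= !coefD IH rayZ mcoeffZ coefZ mcoeffX rayXm.
congr (c * _ + _); rewrite coefZ coefXn eq_sym mdeg_eq0.
case: eqVneq => [->|_]; last by rewrite mulr0.
by rewrite mulr1 big1 // => i _; rewrite mnm0E.
Qed.

Lemma ray1 p f : (ray p f)`_1 = \sum_i p i * f@_U_(i).
Proof.
elim/mpolyind: f => [|c m f _ _ IH].
  by rewrite !raddf0 coef0 big1 // => i _; rewrite mcoeff0 mulr0.
rewrite !rmorphD /= !coefD IH rayZ coefZ rayXm coefZ coefXn.
under [RHS]eq_bigr do rewrite mcoeffD mulrDr mcoeffZ mcoeffX mulrCA.
rewrite big_split /= -mulr_sumr; congr (c * _ + _).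
rewrite eq_sym; case: mdeg1P => [[i /eqP mi]|m1].
  rewrite mulr1 (bigD1 i) //= [RHS](bigD1 i) //= mi mnm1E eqxx expr1 !big1.
  - by rewrite mulr1 addr0 eqxx mulr1.
  - by move=> j; rewrite eq_sym => /negPf ji; rewrite eq_mnm1 ji mulr0.
  - by move=> j; rewrite eq_sym => /negPf ji; rewrite mnm1E ji.
rewrite mulr0 big1 // => i _; case: eqVneq => [mi|]; last by rewrite mulr0.
by case: m1; exists i; apply/eqP.
Qed.

End Ray.

(** * Constant and linear coefficients of polynomials *)

Section LowDegree.
Local Open Scope ring_scope.
Variables (k : fieldType) (n : nat).
Implicit Types f g : {mpoly k[n]}.

(** Restricting to a coordinate axis turns the product rule for linear coefficients into the one for
    univariate polynomials. *)
Lemma ray_delta i f : (ray (fun j => (j == i)%:R) f)`_1 = f@_U_(i).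
Proof.
rewrite ray1 (bigD1 i) //= eqxx mul1r big1 ?addr0 // => j /negPf ->.
by rewrite mul0r.
Qed.

Lemma mcoeffMU f g i :
  (f * g)@_U_(i) = f@_0 * g@_U_(i) + f@_U_(i) * g@_0.
Proof.
rewrite -!ray_delta rmorphM coefM big_ord_recl big_ord1 /= !ray_delta.
by rewrite !ray0.
Qed.

Lemma mdeg_gt0_split (m : 'X_{1..n}) :
  (0 < mdeg m)%N -> exists i m', m = (U_(i) + m')%MM.
Proof.
rewrite lt0n mdeg_eq0 => m0; case: (pickP (fun i => m i != 0%N)) => [i mi|mE].
  exists i, (m - U_(i))%MM; rewrite addmC submK //.
  by apply/mnm_lepP => j; rewrite mnm1E; case: eqVneq => // <-; rewrite lt0n.
by case/eqP: m0; apply/mnmP => i; rewrite mnm0E; apply/eqP/negbFE/mE.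
Qed.

End LowDegree.

(** * Low-degree coefficients on the edge ring, and its maximal ideal *)

Section EdgeRing.
Local Open Scope ring_scope.
Local Open Scope quotient_scope.
Variables (k : fieldType) (n : nat) (G : sgraph n).
Local Notation R := (edge_ring k G).
Local Notation pi := (@edge_proj k n G).
Local Notation mm := (@edge_max k n G).
Implicit Types (f g : {mpoly k[n]}) (a b x y : R).

Lemma edge_proj_surj a : exists f, pi f = a.
Proof. by exists (repr (a : {ideal_quot _})); exact: reprK. Qed.

Definition edge_rep a : {mpoly k[n]} := projT1 (cid (edge_proj_surj a)).

Lemma edge_repK a : pi (edge_rep a) = a.
Proof. exact: (projT2 (cid (edge_proj_surj a))). Qed.

Lemma edge_proj_eqP f g :
  ideal_gen (@edge_monomials k n G) (f - g) <-> pi f = pi g.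
Proof.
have E : edge_ideal G (f - g) = (pi f == pi g).
  exact: (Quotient.idealrBE (@edge_ideal k n G : idealr {mpoly k[n]})).
split=> [fg|/eqP fg]; first by apply/eqP; rewrite -E; apply/asboolP.
by apply/asboolP; rewrite -/(edge_ideal G _) E.
Qed.

Lemma edge_proj_edge i j : G i j -> pi 'X_i * pi 'X_j = 0.
Proof.
move=> Gij; rewrite -rmorphM -(rmorph0 pi); apply/edge_proj_eqP; rewrite subr0.
by apply: ideal_gen_mem; exists i, j.
Qed.

(** The descent criterion for every functional below. Additivity suffices because the multiplier [f]
    of an edge monomial is arbitrary. *)
Lemma edge_functional (phi : {mpoly k[n]} -> k) :
    {morph phi : f g / f + g} ->
    (forall f i j, G i j -> phi (f * ('X_i * 'X_j)) = 0) ->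
  forall f g, pi f = pi g -> phi f = phi g.
Proof.
move=> phiD phiE f g /edge_proj_eqP [s [sE fgE]].
rewrite -[f](subrK g) phiD fgE.
have phi0: phi 0 = 0 by apply: (addrI (phi 0)); rewrite -phiD !addr0.
rewrite (big_morph phi phiD phi0) big_seq big1 ?add0r // => q /sE [i [j [Gij ->]]].
exact: phiE.
Qed.

(** Every edge monomial restricts to a multiple of ['X^2], so degrees 0 and 1 descend along any ray,
    whatever its support. *)
Lemma edge_coef_lt2 p e f g :
  (e < 2)%N -> pi f = pi g -> (ray p f)`_e = (ray p g)`_e.
Proof.
move=> e2; apply: (@edge_functional (fun h => (ray p h)`_e)) => [u v|u i j _].
  by rewrite rmorphD coefD.
rewrite !rmorphM /= !rayX -scalerAl -!scalerAr -expr2 !coefZ.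
by rewrite coefMXn e2 !mulr0.
Qed.

Definition cst a : k := (edge_rep a)@_0.
Definition lin i a : k := (edge_rep a)@_U_(i).

Lemma cst_proj f : cst (pi f) = f@_0.
Proof.
rewrite /cst -!(ray0 (fun=> 0)); apply: edge_coef_lt2 => //; exact: edge_repK.
Qed.

Lemma lin_proj i f : lin i (pi f) = f@_U_(i).
Proof.
rewrite /lin -!ray_delta; apply: edge_coef_lt2 => //; exact: edge_repK.
Qed.

Lemma lin_rayE p f : (ray p f)`_1 = \sum_i p i * lin i (pi f).
Proof. by rewrite ray1; apply: eq_bigr => i _; rewrite lin_proj. Qed.

Lemma cst_is_zmod_morphism : zmod_morphism cst.
Proof.
move=> a b; rewrite -(edge_repK a) -(edge_repK b) -rmorphB !cst_proj.
exact: mcoeffB.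
Qed.
HB.instance Definition _ :=
  GRing.isZmodMorphism.Build R k cst cst_is_zmod_morphism.

Lemma lin_is_zmod_morphism i : zmod_morphism (lin i).
Proof.
move=> a b; rewrite -(edge_repK a) -(edge_repK b) -rmorphB !lin_proj.
exact: mcoeffB.
Qed.
HB.instance Definition _ i :=
  GRing.isZmodMorphism.Build R k (lin i) (lin_is_zmod_morphism i).

Lemma cstM a b : cst (a * b) = cst a * cst b.
Proof.
rewrite -(edge_repK a) -(edge_repK b) -rmorphM !cst_proj.
exact: rmorphM.
Qed.

Lemma linM i a b : lin i (a * b) = cst a * lin i b + lin i a * cst b.
Proof.
rewrite -(edge_repK a) -(edge_repK b) -rmorphM !cst_proj !lin_proj.
exact: mcoeffMU.
Qed.

Lemma edge_projZ c f : pi (c *: f) = c *: pi f.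
Proof. by rewrite -mul_mpolyC rmorphM. Qed.

Lemma linZ i c a : lin i (c *: a) = c * lin i a.
Proof. by rewrite -(edge_repK a) -edge_projZ !lin_proj mcoeffZ. Qed.

Lemma lin_comb i (d : nat) (c : 'I_d -> k) (b : 'I_d -> R) :
  lin i (\sum_j c j *: b j) = \sum_j c j * lin i (b j).
Proof. by rewrite raddf_sum; apply: eq_bigr => j _; rewrite /= linZ. Qed.

Lemma edge_maxP a : mm a <-> cst a = 0.
Proof.
split=> [[f fX <-]|].
  rewrite cst_proj; case: fX => s [sX ->]; rewrite raddf_sum big_seq big1 // => q.
  move=> /sX [i ->] /=; rewrite rmorphM /= mcoeffX.
  by rewrite mnm1_eq0 mulr0.
rewrite -(edge_repK a) cst_proj => a0; exists (edge_rep a) => //.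
move: (edge_rep a) a0 => f f0; rewrite [f]mpolyE.
have idX := ideal_gen_ideal [set q : {mpoly k[n]} | exists i : 'I_n, q = 'X_i].
rewrite big_seq; apply: ideal_sum => // m mf.
have /mdeg_gt0_split [i [m' ->]] : (0 < mdeg m)%N.
  rewrite lt0n mdeg_eq0; apply: contraTneq mf => ->.
  by rewrite mcoeff_msupp f0 eqxx.
rewrite mpolyXD mulrC scalerAl; case: idX => _ _; apply.
by apply: ideal_gen_mem; exists i.
Qed.

Lemma edge_max_ideal : is_ideal mm.
Proof.
split=> [|x y|a x]; rewrite !edge_maxP ?raddf0 // ?raddfD /=.
  by move=> -> ->; rewrite addr0.
by rewrite cstM => ->; rewrite mulr0.
Qed.

Lemma edge_maxX i : mm (pi 'X_i).
Proof. by apply/edge_maxP; rewrite cst_proj mcoeffX mnm1_eq0. Qed.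

(** The right-hand condition defines an ideal containing all products from [mm]. Conversely, it
    leaves only monomials of degree at least 2 in the representative, and each of these splits off
    two variables. *)
Lemma edge_max2P a :
  ideal_mul mm mm a <-> cst a = 0 /\ forall i, lin i a = 0.
Proof.
split.
  move: a; apply: ideal_mul_sub => [|x y].
    split=> [|x y [x0 xl] [y0 yl]|a x [x0 xl]].
    - by split=> [|i]; rewrite raddf0.
    - by split=> [|i]; rewrite raddfD /= ?x0 ?y0 ?xl ?yl addr0.
    - by split=> [|i]; rewrite ?cstM ?linM ?x0 ?xl !mulr0 ?addr0.
  move=> /edge_maxP x0 /edge_maxP y0; split=> [|i].
    by rewrite cstM x0 mul0r.
  by rewrite linM x0 y0 mul0r mulr0 addr0.
rewrite -(edge_repK a) cst_proj; move: (edge_rep a) => f [f0 fl].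
rewrite [f]mpolyE big_seq rmorph_sum; apply: ideal_sum => [|m mf].
  exact: ideal_mul_ideal.
have /mdeg_gt0_split [i [m' mE]] : (0 < mdeg m)%N.
  rewrite lt0n mdeg_eq0; apply: contraTneq mf => ->.
  by rewrite mcoeff_msupp f0 eqxx.
have /mdeg_gt0_split [j [m'' m'E]] : (0 < mdeg m')%N.
  rewrite lt0n mdeg_eq0; apply: contraTneq mf => m'0.
  by rewrite mcoeff_msupp mE m'0 addm0 -lin_proj fl eqxx.
rewrite mE m'E /= edge_projZ !mpolyXD !rmorphM /= mulrCA mulrA mulrC scalerAl.
by case: (ideal_mul_ideal mm mm) => _ _; apply; apply: ideal_mulM; exact: edge_maxX.
Qed.

End EdgeRing.

(** * Lower bounds on the number of generators *)

Section LowerBounds.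
Local Open Scope classical_set_scope.
Local Open Scope ring_scope.
Variables (k : fieldType) (n : nat) (G : sgraph n).
Local Notation R := (edge_ring k G).
Local Notation pi := (@edge_proj k n G).
Local Notation mm := (@edge_max k n G).
Implicit Types (f g : {mpoly k[n]}) (a b x y : R) (J : set R).

(** Hence a relation modulo [ideal_mul mm J] is an equality of linear parts. *)
Lemma ideal_mul_edge_max J : J `<=` mm -> ideal_mul mm J `<=` ideal_mul mm mm.
Proof.
move=> Jm; apply: ideal_mul_sub => [|x y mx /Jm]; first exact: ideal_mul_ideal.
exact: ideal_mulM.
Qed.

Section IndependentRay.
Variables (p : 'I_n -> k) (pG : forall i j, G i j -> p i * p j = 0).

(** When [p] is supported on an independent set, the ray kills all edge monomials, so it descends in
    every degree to a ring map. *)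
Definition eray a : {poly k} := ray p (edge_rep a).

Lemma eray_proj f : eray (pi f) = ray p f.
Proof.
apply/polyP => e; apply: (@edge_functional _ _ G (fun h => (ray p h)`_e)).
- by move=> u v; rewrite rmorphD coefD.
- move=> u i j /pG pij.
  by rewrite !rmorphM /= !rayX -scalerAl -!scalerAr scalerA pij scale0r coef0.
- exact: edge_repK.
Qed.

Lemma erayD a b : eray (a + b) = eray a + eray b.
Proof.
by rewrite -(edge_repK a) -(edge_repK b) -rmorphD !eray_proj rmorphD.
Qed.

Lemma erayM a b : eray (a * b) = eray a * eray b.
Proof.
by rewrite -(edge_repK a) -(edge_repK b) -rmorphM !eray_proj rmorphM.
Qed.

Lemma erayZ c a : eray (c *: a) = c *: eray a.
Proof. by rewrite -(edge_repK a) -edge_projZ !eray_proj rayZ. Qed.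

Lemma eray_sum (d : nat) (F : 'I_d -> R) :
  eray (\sum_i F i) = \sum_i eray (F i).
Proof.
apply: (big_morph _ erayD); rewrite -(rmorph0 pi) eray_proj; exact: raddf0.
Qed.

Lemma eray0 a : (eray a)`_0 = cst a.
Proof. exact: ray0. Qed.

Lemma eray1 a : (eray a)`_1 = \sum_i p i * lin i a.
Proof. by rewrite /eray (lin_rayE G) edge_repK. Qed.

(** Along the ray, a factor from [mm] has order at least 1 and one from [J] order at least 2, so
    products have order at least 3. *)
Lemma eray2_ideal_mul J : J `<=` mm ->
    (forall x, J x -> (eray x)`_1 = 0) ->
  forall x, ideal_mul mm J x -> (eray x)`_2 = 0.
Proof.
move=> Jm J1 x xJ.
(* Vanishing of the ['X^2] coefficient alone is not stable under multiplication; vanishing of all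
   coefficients below degree 3 is. *)
suff: forall e, (e < 3)%N -> (eray x)`_e = 0 by apply.
move: x xJ; apply: ideal_mul_sub => [|a x /edge_maxP a0 Jx].
  split=> [|x y x0 y0|a x x0] e e3.
  - by rewrite -(rmorph0 pi) eray_proj raddf0 coef0.
  - by rewrite erayD coefD x0 // y0 // addr0.
  - rewrite erayM coefM big1 // => i _; rewrite x0 ?mulr0 //.
    exact: leq_ltn_trans (leq_subr _ _) e3.
have /edge_maxP x0 := Jm _ Jx.
move=> e e3; rewrite erayM coefM big1 // => -[[|i] ilt] _ /=.
  by rewrite eray0 a0 mul0r.
have : (e - i.+1 < 2)%N by rewrite ltnS leq_subLR addn1 -ltnS (leq_trans e3).
by case: (e - i.+1)%N => [|[|//]] _; rewrite ?eray0 ?x0 ?J1 ?mulr0.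
Qed.

End IndependentRay.

Lemma mu_ge_independent J d s (v : 'I_s -> 'I_n) :
    injective v -> (forall i j, ~~ G (v i) (v j)) ->
    J `<=` mm -> ideal_mul mm mm `<=` J -> mu_is J d -> (s <= d)%N.
Proof.
move=> vI vG Jm mJ [b [Jb Jspan _]].
pose L := \matrix_(i < d, j < s) lin (v j) (b i).
(* The columns of [N] are a basis of the vectors on which the linear parts of all the [b i] vanish,
   and [A] below is a left inverse of [N]. *)
pose N := col_base (cokermx L).
have LN : L *m N = 0.
  apply: (row_free_inj (row_base_free (cokermx L))).
  by rewrite -mulmxA mulmx_base mulmx_coker mul0mx.
have /row_fullP [A AN] : row_full N by exact: col_base_full.
(* Column [j] of [N] extended by zero outside the independent set; injectivity of [v] leaves at most
   one term. *)
pose p j (i : 'I_n) := \sum_(t | v t == i) N t j.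
have pv j t : p j (v t) = N t j.
  by rewrite /p (eq_bigl (pred1 t)) ?big_pred1_eq // => u; rewrite (inj_eq vI).
have pP j i : p j i != 0 -> exists t, v t = i.
  apply: contra_neqP => nt; rewrite /p big1 // => t /eqP vt.
  by case: nt; exists t.
have pG j i i' : G i i' -> p j i * p j i' = 0.
  move=> Gii'; have [->|/pP[t ti]] := eqVneq (p j i) 0; first by rewrite mul0r.
  have [->|/pP[t' ti']] := eqVneq (p j i') 0; first by rewrite mulr0.
  by move: (vG t t'); rewrite ti ti' Gii'.
have plin j x : (eray (p j) x)`_1 = \sum_t N t j * lin (v t) x.
  rewrite eray1 /p.
  under eq_bigr do rewrite mulr_suml big_mkcond /=.
  rewrite exchange_big /=; apply: eq_bigr => t _.
  by rewrite -big_mkcond /= (big_pred1 (v t)) // => i; rewrite eq_sym.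
have lin_mulJ x i : ideal_mul mm J x -> lin i x = 0.
  by move=> /(ideal_mul_edge_max Jm) /edge_max2P [_].
have J1 j x : J x -> (eray (p j) x)`_1 = 0.
  move=> /Jspan [c cx]; rewrite plin.
  have lx t : lin (v t) x = \sum_i c i * L i t.
    have := lin_mulJ _ (v t) cx; rewrite raddfB /= lin_comb => /eqP.
    rewrite subr_eq0 => /eqP ->.
    by apply: eq_bigr => i _; rewrite mxE.
  under eq_bigr do rewrite lx mulr_sumr.
  rewrite exchange_big big1 //= => i _.
  under eq_bigr do rewrite mulrCA.
  rewrite -mulr_sumr; have /matrixP /(_ i j) := LN; rewrite !mxE.
  by under eq_bigr do rewrite mulrC; move=> ->; rewrite mulr0.
(* Linear forms dual to the points [p j]: along ray [j], the square of [u i] has ['X^2] coefficient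
   1 if [i = j] and 0 otherwise. *)
pose u i := \sum_t A i t *: pi 'X_(v t).
have mu i : mm (u i).
  apply: ideal_sum => [|t _]; first exact: edge_max_ideal.
  by case: (@edge_max_ideal k n G) => _ _; apply; exact: edge_maxX.
have uN i j : (eray (p j) (u i))`_1 = (i == j)%:R.
  rewrite /u (eray_sum (pG j)) coef_sum.
  under eq_bigr do rewrite (erayZ (pG j)) coefZ (eray_proj (pG j)) rayX coefZ coefX mulr1 pv.
  by have /matrixP /(_ i j) := AN; rewrite !mxE.
have /choice [C CP] : forall i, exists c : 'I_d -> k,
    ideal_mul mm J (u i * u i - \sum_j c j *: b j).
  by move=> i; apply/Jspan/mJ/ideal_mulM.
pose Cm := \matrix_(i, j) C i j.
(* The square of [u i] has no linear part, so its coordinates in [b] give a relation between the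
   linear parts of the generators. *)
have CL : Cm *m L = 0.
  apply/matrixP => i t; rewrite !mxE; under eq_bigr do rewrite !mxE.
  have := lin_mulJ _ (v t) (CP i); rewrite raddfB /= lin_comb linM.
  have /edge_maxP -> := mu i.
  by rewrite mul0r mulr0 addr0 sub0r => /eqP; rewrite oppr_eq0 => /eqP.
pose Q := \matrix_(i, j) (eray (p j) (b i))`_2.
have CQ : Cm *m Q = 1%:M.
  apply/matrixP => i j; rewrite !mxE; under eq_bigr do rewrite !mxE.
  have := eray2_ideal_mul (pG j) Jm (J1 j) (CP i).
  rewrite -scaleN1r (erayD (pG j)) (erayZ (pG j)) coefD coefZ mulN1r => /eqP.
  rewrite subr_eq0 (eray_sum (pG j)) coef_sum.
  under [X in _ == X]eq_bigr do rewrite (erayZ (pG j)) coefZ.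
  move=> /eqP <-; rewrite (erayM (pG j)) coefM !big_ord_recl big_ord0 /= addr0.
  have /edge_maxP u0 := mu i.
  rewrite !eray0 u0 mul0r mulr0 addr0 add0r !uN.
  by case: (i == j); rewrite ?mulr1 ?mulr0.
have rC : \rank Cm = \rank (cokermx L).
  by apply/eqP/row_freeP; exists Q.
have : (Cm <= kermx L)%MS by rewrite sub_kermx CL.
(* This reads [s - \rank L <= d - \rank L]; the bounds on [\rank L] then undo the truncated
   subtractions. *)
move=> /mxrankS; rewrite rC mxrank_ker mxrank_coker.
have := rank_leq_row L; have := rank_leq_col L; move: (\rank L) => r rs rd.
by rewrite -(leq_add2r r) !subnK.
Qed.

(** [E] lists the edges up to orientation; having fewer edges than vertices leaves a nonzero
    solution [l] of the edge conditions. *)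
Lemma square_hyperplane J m (E : 'I_m -> 'I_n * 'I_n) (c : 'I_n -> k) q :
    (m < n)%N ->
    (forall i j, G i j -> exists e, E e = (i, j) \/ E e = (j, i)) ->
    c q != 0 -> J `<=` mm -> (forall x, J x -> \sum_i c i * lin i x = 0) ->
  ~ (ideal_mul mm mm `<=` ideal_mul J J).
Proof.
move=> mn EG cq Jm Jc mJ.
(* Column [e] is the condition on [l] that [phi] below vanish on edge [e]. The subtracted term keeps
   the form nonzero in characteristic 2 as well, where [l = c] would otherwise give zero. *)
pose M := \matrix_(r < n, e < m)
  (c (E e).1 * (r == (E e).2)%:R + c (E e).2 * (r == (E e).1)%:R
   - c (E e).1 * c (E e).2 / c q * (r == q)%:R).
have /rowV0Pn [l /sub_kermxP lM /rV0Pn [j0 lj0]] : kermx M != 0.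
  by rewrite -mxrank_eq0 mxrank_ker subn_eq0 -ltnNge (leq_ltn_trans (rank_leq_col M)).
pose s := l 0 q / c q; pose l' i := l 0 i.
(* [phi] is the form [c l + l c - (l_q / c_q) c c]: its [x_q x_j]-coefficient is
   [c_q l_j], so it is nonzero. *)
pose phi f := (ray (fun i => c i + l' i) f)`_2 - (ray c f)`_2 - (ray l' f)`_2
              - s * (ray c f)`_2.
have phiD : {morph phi : f g / f + g}.
  by move=> f g; rewrite /phi !rmorphD /= !coefD; ring.
have rayXX p f i j : (ray p (f * ('X_i * 'X_j)))`_2 = f@_0 * (p i * p j).
  rewrite !rmorphM /= !rayX -scalerAl -!scalerAr -expr2 !coefZ coefMXn /= ray0.
  by rewrite [f@_0 * _]mulrC mulrA.
have phiXX f i j : phi (f * ('X_i * 'X_j)) =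
    f@_0 * (c i * l' j + c j * l' i - s * (c i * c j)).
  by rewrite /phi !rayXX; ring.
have sumd i : \sum_r l 0 r * (r == i)%:R = l' i.
  rewrite (bigD1 i) //= eqxx mulr1 big1 ?addr0 // => r /negPf ->.
  by rewrite mulr0.
have lE e : c (E e).1 * l' (E e).2 + c (E e).2 * l' (E e).1
    - s * (c (E e).1 * c (E e).2) = 0.
  have /rowP /(_ e) := lM; rewrite !mxE => <-.
  rewrite -!sumd /s -[l 0 q]/(l' q) -[l' q]sumd !mulr_sumr !mulr_suml.
  rewrite -sumrN -!big_split /=; apply: eq_bigr => r _; rewrite !mxE; ring.
have phiG f i j : G i j -> phi (f * ('X_i * 'X_j)) = 0.
  move=> /EG [e ee]; rewrite phiXX -[RHS](mulr0 f@_0) -(lE e).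
  by case: ee => -> /=; congr (_ * _); rewrite // addrC mulrCA; ring.
have phi_pi := @edge_functional _ _ G phi phiD phiG.
have phiJ x : ideal_mul J J x -> phi (edge_rep x) = 0.
  case=> t [tJ xE].
  (* Chosen representatives do not respect sums or products; since [phi] descends, a convenient
     representative may replace them. *)
  pose f := \sum_(z <- t) edge_rep z.1 * edge_rep z.2.
  have -> : phi (edge_rep x) = phi f.
    apply: phi_pi; rewrite edge_repK rmorph_sum xE; apply: eq_bigr => z _.
    by rewrite /= rmorphM /= !edge_repK.
  have phi0: phi 0 = 0 by apply: (addrI (phi 0)); rewrite -phiD !addr0.
  rewrite /f (big_morph phi phiD phi0) big_seq big1 // => z /tJ [u [w [Ju Jw ->]]].
  have /edge_maxP u0 := Jm _ Ju; have /edge_maxP w0 := Jm _ Jw.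
  have -> : phi (edge_rep z.1 * edge_rep (u * w)) =
            phi (edge_rep z.1 * (edge_rep u * edge_rep w)).
    by apply: phi_pi; rewrite !rmorphM /= !edge_repK.
  (* As [u] and [w] have no constant term, only their linear parts contribute; every term of [phi]
     then contains a factor killed by [Jc]. *)
  have ray2 p : (ray p (edge_rep z.1 * (edge_rep u * edge_rep w)))`_2
      = (edge_rep z.1)@_0 * ((ray p (edge_rep u))`_1 * (ray p (edge_rep w))`_1).
    rewrite !rmorphM /= coefM !big_ord_recl big_ord0 /= !coefM.
    rewrite !big_ord_recl !big_ord0 /= !ray0.
    rewrite /cst in u0 w0; rewrite u0 w0; ring.
  rewrite /phi !ray2 !(lin_rayE G) !edge_repK !Jc //.
  under eq_bigr do rewrite mulrDl.
  under [X in _ * (_ * X)]eq_bigr do rewrite mulrDl.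
  rewrite !big_split /= !Jc //; ring.
have : phi (edge_rep (pi 'X_q * pi 'X_j0)) = 0.
  by apply/phiJ/mJ/ideal_mulM; exact: edge_maxX.
rewrite (phi_pi _ (1 * ('X_q * 'X_j0))); last by rewrite edge_repK mul1r rmorphM.
rewrite phiXX mcoeff1 eqxx mul1r /s -/(l' q).
have -> : c q * l' j0 + c j0 * l' q - l' q / c q * (c q * c j0) = c q * l' j0.
  by field.
by apply/eqP; rewrite mulf_neq0.
Qed.

(** With [d < n], the linear parts of the generators have a common nonzero annihilator [c], which
    then annihilates the linear parts of all of [J]. *)
Lemma mu_ge_reduction J m d (E : 'I_m -> 'I_n * 'I_n) :
    (m < n)%N ->
    (forall i j, G i j -> exists e, E e = (i, j) \/ E e = (j, i)) ->
    J `<=` mm -> ideal_mul mm mm `<=` ideal_mul J J -> mu_is J d -> (n <= d)%N.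
Proof.
move=> mn EG Jm mJ [b [Jb Jspan _]]; rewrite leqNgt; apply/negP => dn.
pose L := \matrix_(i < n, j < d) lin i (b j).
have /rowV0Pn [c /sub_kermxP cL /rV0Pn [q cq]] : kermx L != 0.
  by rewrite -mxrank_eq0 mxrank_ker subn_eq0 -ltnNge (leq_ltn_trans (rank_leq_col L)).
apply: (square_hyperplane mn EG cq Jm _ mJ) => x /Jspan [a].
move=> /(ideal_mul_edge_max Jm) /edge_max2P [_ xa].
have lx i : lin i x = \sum_j a j * lin i (b j).
  by apply/eqP; rewrite -subr_eq0 -lin_comb -raddfB; apply/eqP/xa.
under eq_bigr do rewrite lx mulr_sumr.
rewrite exchange_big big1 //= => j _.
under eq_bigr do rewrite mulrCA.
rewrite -mulr_sumr; have /rowP /(_ j) := cL; rewrite !mxE.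
by under eq_bigr do rewrite !mxE; move=> ->; rewrite mulr0.
Qed.

End LowerBounds.

(** * Hyperplane ideals and explicit minimal generators *)

Section UpperBounds.
Local Open Scope classical_set_scope.
Local Open Scope ring_scope.

Section Hyperplane.
Variables (k : fieldType) (n : nat) (G : sgraph n).
Local Notation R := (edge_ring k G).
Local Notation pi := (@edge_proj k n G).
Local Notation mm := (@edge_max k n G).
Implicit Types (f : {mpoly k[n]}) (x y : R) (J L : set R) (c : 'I_n -> k).

(** The value [c = 0] is allowed and gives [mm], so homogeneity of [mm] is a special case. *)
Definition hyperplane_ideal c : set R :=
  [set x | cst x = 0 /\ \sum_i c i * lin i x = 0].

Lemma hyperplane_ideal_sub c : hyperplane_ideal c `<=` mm.
Proof. by move=> x [/edge_maxP]. Qed.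

Lemma hyperplane_ideal0 : hyperplane_ideal (fun=> 0) = mm.
Proof.
apply/seteqP; split=> [x [/edge_maxP]//|x /edge_maxP x0]; split=> //.
by rewrite big1 // => i _; rewrite mul0r.
Qed.

Lemma sub_hyperplane_ideal c : ideal_mul mm mm `<=` hyperplane_ideal c.
Proof.
move=> x /edge_max2P [x0 xl]; split=> //.
by rewrite big1 // => i _; rewrite xl mulr0.
Qed.

Lemma hyperplane_ideal_is_ideal c : is_ideal (hyperplane_ideal c).
Proof.
split.
- by split; rewrite ?raddf0 // big1 // => i _; rewrite raddf0 mulr0.
- move=> x y [x0 xl] [y0 yl]; split; first by rewrite raddfD /= x0 y0 addr0.
  under eq_bigr do rewrite raddfD mulrDr.
  by rewrite big_split /= xl yl addr0.
- move=> a x [x0 xl]; split; first by rewrite cstM x0 mulr0.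
  under eq_bigr do rewrite linM x0 mulr0 addr0 mulrCA.
  by rewrite -mulr_sumr xl mulr0.
Qed.

(** Membership is the vanishing of the coefficients of degrees 0 and 1 along the ray [c], which
    homogeneous components inherit. *)
Lemma hyperplane_ideal_homog c : homog_ideal (hyperplane_ideal c).
Proof.
split=> [|x [x0 xl]]; first exact: hyperplane_ideal_is_ideal.
pose f := edge_rep x.
exists (msize f), (fun d => pi (pihomog mdeg d f)); split=> [d|]; last first.
  by rewrite -rmorph_sum /= -pihomog_partitionE ?edge_repK.
split; last by exists (pihomog mdeg d f) => //; exact: pihomogP.
split.
  rewrite cst_proj -(ray0 c) ray_pihomog ray0 -/(cst x) x0.
  by rewrite if_same.
rewrite -lin_rayE ray_pihomog (lin_rayE G) edge_repK xl.
by rewrite if_same.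
Qed.

Lemma edge_max_homog : homog_ideal mm.
Proof. rewrite -hyperplane_ideal0; exact: hyperplane_ideal_homog. Qed.

Lemma edge_max_gen L : is_ideal L -> (forall i, L (pi 'X_i)) -> mm `<=` L.
Proof.
move=> [L0 LD LM] LX x [f fX <-].
move: f fX; apply: (@ideal_gen_sub _ _ [set f | L (pi f)]) => [|f [i ->]]; last first.
  exact: LX.
split=> [|u v|u v] /=; rewrite ?rmorph0 ?rmorphD ?rmorphM //.
- exact: LD.
- exact: LM.
Qed.

Lemma edge_max2_gen L : is_ideal L ->
  (forall i j, L (pi 'X_i * pi 'X_j)) -> ideal_mul mm mm `<=` L.
Proof.
move=> idL LXX; have [L0 LD LM] := idL.
apply: ideal_mul_sub => // x y xm ym; move: x xm.
apply: (@edge_max_gen [set x | L (x * y)]) => [|i /=].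
  split=> [|u v|a u] /=; rewrite ?mul0r // ?mulrDl -?mulrA.
  - exact: LD.
  - exact: LM.
move: y ym; apply: (@edge_max_gen [set y | L (pi 'X_i * y)]) => [|j] //=.
split=> [|u v|a u] /=; rewrite ?mulr0 // ?mulrDr 1?mulrCA.
- exact: LD.
- exact: LM.
Qed.

(** Here [ideal_mul mm J] equals the square of [mm], so the quotient of [J] by it is the space of
    linear parts of [J]. *)
Lemma mu_is_linear J d (b : 'I_d -> R) :
    J `<=` mm -> is_ideal J -> ideal_mul mm mm `<=` ideal_mul mm J ->
    (forall j, J (b j)) ->
    (forall x, J x -> exists c : 'I_d -> k,
       forall i, lin i x = \sum_j c j * lin i (b j)) ->
    (forall c : 'I_d -> k,
       (forall i, \sum_j c j * lin i (b j) = 0) -> forall j, c j = 0) ->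
  mu_is J d.
Proof.
move=> Jm idJ mJ Jb Jspan bfree; exists b; split=> // [x Jx|c cJ].
  have [c cE] := Jspan x Jx; exists c; apply/mJ/edge_max2P; split.
    apply/edge_maxP/Jm; apply: ideal_sub => //; apply: ideal_sum => // j _.
    by case: idJ => _ _; apply.
  by move=> i; rewrite raddfB /= lin_comb cE subrr.
apply: bfree => i; rewrite -lin_comb.
by have /edge_max2P [_] := ideal_mul_edge_max Jm cJ.
Qed.

Lemma lin_projX i j : lin i (pi 'X_j) = (j == i)%:R.
Proof. by rewrite lin_proj mcoeffXU. Qed.

Lemma mu_edge_max : mu_is mm n.
Proof.
have linX (c : 'I_n -> k) i : \sum_j c j * lin i (pi 'X_j) = c i.
  rewrite (bigD1 i) //= lin_projX eqxx mulr1 big1 ?addr0 // => j ji.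
  by rewrite lin_projX (negPf ji) mulr0.
apply: (@mu_is_linear _ _ (fun i => pi 'X_i)) => //.
- exact: edge_max_ideal.
- exact: edge_maxX.
- by move=> x _; exists (fun i => lin i x) => i; rewrite linX.
- by move=> c c0 j; rewrite -[c j]linX.
Qed.

End Hyperplane.

Section EdgeHyperplane.
Variables (k : fieldType) (d : nat) (G : sgraph d.+1) (i0 i1 : 'I_d.+1).
Hypothesis G01 : G i0 i1.
Local Notation pi := (@edge_proj k d.+1 G).
Local Notation mm := (@edge_max k d.+1 G).

Let c (i : 'I_d.+1) : k := (i == i0)%:R + (i == i1)%:R.
Local Notation J := (@hyperplane_ideal k d.+1 G c).

Let i01 : i1 != i0.
Proof. by apply: contraTneq G01 => ->; rewrite edge_irr. Qed.

Let G10 : G i1 i0.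
Proof. by rewrite edge_sym. Qed.

Let sum_c (F : 'I_d.+1 -> k) : \sum_i c i * F i = F i0 + F i1.
Proof.
rewrite /c; under eq_bigr do rewrite mulrDl; rewrite big_split /=.
by congr (_ + _); [rewrite (bigD1 i0)|rewrite (bigD1 i1)]; rewrite //= eqxx mul1r big1 ?addr0 // => i /negPf ->;
  rewrite mul0r.
Qed.

Let J_X i : i != i0 -> i != i1 -> J (pi 'X_i).
Proof.
move=> /negPf i0' /negPf i1'; split; first by rewrite cst_proj mcoeffX mnm1_eq0.
by rewrite sum_c !lin_projX i0' i1' addr0.
Qed.

Let J_01 : J (pi 'X_i1 - pi 'X_i0).
Proof.
split; first by rewrite raddfB /= !cst_proj !mcoeffX !mnm1_eq0 subrr.
rewrite sum_c !raddfB /= !lin_projX !eqxx (negPf i01) eq_sym (negPf i01) sub0r subr0.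
exact: addNr.
Qed.

Lemma edge_max2_hyperplane : ideal_mul mm mm `<=` ideal_mul mm J.
Proof.
have idmJ : is_ideal (ideal_mul mm J) by exact: ideal_mul_ideal.
have [mJ0 mJD mJM] := idmJ.
have mX i : mm (pi 'X_i) by exact: edge_maxX.
apply: edge_max2_gen => // i j.
(* A variable other than the two endpoints lies in [J], and the mixed product is zero; only the two
   squares need the difference of the endpoints. *)
have [ji0|jni0] := eqVneq j i0; have [ji1|jni1] := eqVneq j i1; last first.
- exact/ideal_mulM/J_X.
- have [ii0|ini0] := eqVneq i i0.
    by rewrite edge_proj_edge ?ii0 ?ji1.
  have [->|ini1] := eqVneq i i1; last by rewrite mulrC; exact/ideal_mulM/J_X.
  rewrite ji1.
  have -> : pi 'X_i1 * pi 'X_i1 = pi 'X_i1 * (pi 'X_i1 - pi 'X_i0).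
    by rewrite mulrBr (edge_proj_edge k G10) subr0.
  exact: ideal_mulM.
- have [ii1|ini1] := eqVneq i i1.
    by rewrite edge_proj_edge ?ii1 ?ji0 //.
  have [->|ini0] := eqVneq i i0; last by rewrite mulrC; exact/ideal_mulM/J_X.
  rewrite ji0.
  have -> : pi 'X_i0 * pi 'X_i0 = - (pi 'X_i0 * (pi 'X_i1 - pi 'X_i0)).
    by rewrite mulrBr (edge_proj_edge k G01) sub0r opprK.
  by apply: ideal_opp => //; exact: ideal_mulM.
- by move: i01; rewrite -ji0 -ji1 eqxx.
Qed.

Lemma mu_edge_hyperplane : mu_is J d.
Proof.
(* Indexed by the vertices other than [i0]; the linear coefficients at these vertices form the dual
   basis. *)
pose b j := pi 'X_(lift i0 j) - (if lift i0 j == i1 then pi 'X_i0 else 0).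
have linb i j : lin i (b j)
    = (lift i0 j == i)%:R - ((lift i0 j == i1) && (i0 == i))%:R.
  rewrite /b raddfB /= lin_projX; case: ifP => _; first by rewrite lin_projX.
  by rewrite raddf0.
have sum_lift (F : 'I_d -> k) t : \sum_j F j * lin (lift i0 t) (b j) = F t.
  rewrite (bigD1 t) //= linb eqxx (negPf (neq_lift _ _)) andbF subr0 mulr1.
  rewrite big1 ?addr0 // => j /negPf jt.
  by rewrite linb (inj_eq lift_inj) jt (negPf (neq_lift _ _)) andbF subrr mulr0.
apply: (@mu_is_linear _ _ _ _ _ b).
- exact: hyperplane_ideal_sub.
- exact: hyperplane_ideal_is_ideal.
- exact: edge_max2_hyperplane.
- move=> j; rewrite /b; case: eqVneq => [->|]; first exact: J_01.
  by move=> ji1; rewrite subr0; apply: J_X => //; rewrite eq_sym neq_lift.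
- move=> x [_]; rewrite sum_c => xl; exists (fun j => lin (lift i0 j) x) => i.
  case: (unliftP i0 i) => [t ->|->]; first by rewrite sum_lift.
  (* The remaining coefficient, at [i0], is forced by the hyperplane equation to be minus the one at
     [i1]. *)
  move: i01; rewrite eq_sym => /unlift_some [t i1E _].
  rewrite (bigD1 t) //= linb -i1E !eqxx (negPf i01) sub0r mulrN1.
  rewrite big1 ?addr0; first by apply/eqP; rewrite -addr_eq0 xl.
  move=> j jt; rewrite linb eq_sym (negPf (neq_lift _ _)) i1E (inj_eq lift_inj).
  by rewrite (negPf jt) subrr mulr0.
- by move=> F F0 t; rewrite -[F t]sum_lift.
Qed.

End EdgeHyperplane.

End UpperBounds.

(** * Attained minima, and the path graph *)

Section NatMin.
Local Open Scope classical_set_scope.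

(** A witness excludes the default value 0, so the minimum is attained by an actual ideal. *)
Lemma nat_minP (S : set nat) d : S d -> S (nat_min S) /\ nat_min S <= d.
Proof.
move=> Sd; have exS : exists e, `[< S e >] by exists d; apply/asboolP.
case: (ex_minnP exS) => m /asboolP Sm mmin.
have [] : [set d | S d /\ forall e, S e -> (d <= e)%N] (nat_min S).
  by apply: (@xgetI _ _ _ m); split=> // e Se; apply/mmin/asboolP.
by move=> SS Smin; split=> //; apply: Smin.
Qed.

End NatMin.

(** The [n] edges on [n.+1] vertices are enumerated by their lower endpoint. *)
Lemma path_edges n (i j : 'I_n.+1) : path_edge i j ->
  exists e : 'I_n, (inord e, inord e.+1) = (i, j)
                \/ (inord e, inord e.+1) = (j, i).
Proof.
wlog ij : i j / i.+1 = j :> nat => [W /orP[/eqP|/eqP] ij|_].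
- by apply: W => //; rewrite /path_edge ij eqxx.
- have [|e] := W j i ij; first by rewrite /path_edge ij eqxx.
  by move=> ee; exists e; case: ee; [right|left].
have iltn : i < n by rewrite -ltnS ij.
by exists (Ordinal iltn); left; congr (_, _); apply: val_inj; rewrite /= inordK ?ij // ltnW.
Qed.

Theorem proposition6p27 (k : fieldType) (n : nat) (n_ge4 : 4 <= n) :
  cs k (path_graph n) = n /\
  uphalf n <= ms k (path_graph n) <= n.-1.
Proof.
(* From here on the path has [n.+1] vertices and [n] edges, and the upper bound for [ms] is [n]. *)
case: n n_ge4 => // n n_ge4.
split.
  rewrite /cs; set S := (X in nat_min X).
  have Sn : S n.+1.
    exists (@edge_max k n.+1 (path_graph n.+1)); split=> //.
    - exact: edge_max_homog.
    - exact: mu_edge_max.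
  have [[J [_ Jm JJ muJ]] minle] := nat_minP Sn.
  apply/eqP; rewrite eqn_leq minle /=.
  apply: (mu_ge_reduction (E := fun e : 'I_n => (inord e, inord e.+1)) _ _ Jm _ muJ) => //; first exact: path_edges.
  by rewrite JJ.
rewrite /ms; set S := (X in nat_min X).
have i01 : path_graph n.+1 (inord 0) (inord 1).
  by rewrite /= /path_edge !inordK // (ltn_trans _ n_ge4).
have Sn : S n.
  eexists; split; last exact: (mu_edge_hyperplane _ i01).
  - exact: hyperplane_ideal_homog.
  - exact: hyperplane_ideal_sub.
  - exact: sub_hyperplane_ideal.
have [[J [_ Jm mJ muJ]] minle] := nat_minP Sn.
rewrite minle andbT.
(* The even-numbered vertices form an independent set of size [uphalf n.+1]. *)
have dlt (j : 'I_(uphalf n.+1)) : j.*2 < n.+1 by rewrite -gtn_uphalf_double.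
pose v (j : 'I_(uphalf n.+1)) : 'I_n.+1 := Ordinal (dlt j).
apply: (mu_ge_independent (v := v) _ _ Jm mJ muJ).
- by move=> i j /(congr1 val) /= /double_inj /val_inj.
- by move=> i j; rewrite /= /path_edge /=; lia.
Qed.
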